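(* For every epistemic action without postconditions $X\in\mathrm{noPost}$, there is an attention action $Y\in\mathrm{ALL}$ equivalent to $X$.
   Context: Language. $I\neq\emptyset$ is a finite set of agents, $N\in\mathbb{N}=\{0,1,2,\dots\}$ an attention bound, $\Phi$ a countable set of proposition atoms, $\Psi=\{(\alpha_i<n),(\alpha_i=n): n\le N, i\in I\}$ the set of attention atoms, $At=\Phi\uplus\Psi$. The language $\mathcal{L}$ is $\varphi::=\top\mid p\mid\neg\varphi\mid\varphi\wedge\varphi\mid K_i\varphi$ with $p\in At$, $i\in I$. Attention states. An attention model is $M=(W,R,V,A)$ with $W\ne\emptyset$ a finite set of worlds; $R$ assigning to each $i\in I$ an equivalence relation $R_i$ on $W$; $V:At\to\mathcal{P}(W)$ a valuation; and $A:I\times W\to\{0,\dots,N\}$ such that $wR_iv$ implies $A_i(w)=A_i(v)$. For $w\in W$, $(M,w)$ is an attention state. Satisfaction: $M,w\vDash p$ iff $w\in V(p)$ for $p\in\Phi$; $M,w\vDash(\alpha_i=n)$ iff $A_i(w)=n$; $M,w\vDash(\alpha_i<n)$ iff $A_i(w)<n$; $M,w\vDash K_i\varphi$ iff $M,v\vDash\varphi$ for all $v$ with $wR_iv$; standard clauses for $\top,\neg,\wedge$. Write $\varphi\vDash\psi$ if every attention state satisfies $\varphi\to\psi$. Attention actions. An attention action model is $\mathcal{A}=(E,Q,Q^*,pre,c)$ with $E\neq\emptyset$ a finite set of events; $Q,Q^*$ assigning to each $i\in I$ equivalence relations $Q_i,Q_i^*$ on $E$; $pre:E\to\mathcal{L}$;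 and a cost function $c:I\times\mathcal{L}\times E\to\mathbb{N}$ with $c_i(\top,e)=0$ and such that $(e,e')\in Q_i\cup Q_i^*$ implies $c_i(\varphi,e)=c_i(\varphi,e')$, for all $i,\varphi$. A question map is a map $\mathsf{q}:I\to\mathcal{L}$. An attention action is a triple $X=(\mathcal{A},\mathsf{q},e)$ with $e\in E$. $\mathrm{ALL}$ is the class of all attention actions. Attention update. Let $Q_i^*[\varphi|\neg\varphi]$ be the set of $(e,e')\in Q_i^*$ such that ($pre(e)\vDash\varphi$ iff $pre(e')\vDash\varphi$). The update of $(M,w)=((W,R,V,A),w)$ with $X=((E,Q,Q^*,pre,c),\mathsf{q},e)$ is $(M,w)^X=((W^X,R^X,V^X,A^X),(w,e))$, where $W^X=\{(v,f)\in W\times E: M,v\vDash pre(f)\}$; $((v,f),(u,g))\in R_i^X$ iff $(v,u)\in R_i$ and $(f,g)\in Q_i\cup Q_i^*$ in case $c_i(\mathsf{q}_i,f)>A_i(v)$, respectively $(f,g)\in Q_i\cup Q_i^*[\mathsf{q}_i|\neg\mathsf{q}_i]$ in case $c_i(\mathsf{q}_i,f)\le A_i(v)$; $V^X(p)=\{(v,f)\in W^X: v\in V(p)\}$ for $p\in\Phi$; $A_i^X(v,f)=\max\{0,A_i(v)-c_i(\mathsf{q}_i,f)\}$. $X$ is applicable to $(M,w)$ if $M,w\vDash pre(e)$. Epistemic states and actions. An epistemic Kripke model is $K=(W,R,V)$ with $W\neq\emptyset$ finite, each $R_i$ an equivalence relation on $W$, and $V:At\to\mathcal{P}(W)$; $(K,w)$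 with $w\in W$ is an epistemic state; satisfaction is standard, with $K,w\vDash p$ iff $w\in V(p)$ for all $p\in At$. The Kripke rendition of $(M,w)=((W,R,V,A),w)$ is $K(M,w)=((W,R,V_A),w)$ with $V_A(p)=\{v\in W:M,v\vDash p\}$ for all $p\in At$. An action model is $\mathcal{E}=(E,Q,pre,post)$ with $E\ne\emptyset$ finite, each $Q_i$ ($i\in I$) an equivalence relation on $E$, $pre:E\to\mathcal{L}$, $post:E\to(At\to\mathcal{L})$; it is without postconditions if $post(e)(p)=p$ for all $e\in E$, $p\in At$. An epistemic action is $(\mathcal{E},e)$ with $e\in E$. $\mathrm{Post}$ is the class of all epistemic actions, $\mathrm{noPost}$ the class of those without postconditions. The product update of $(K,w)$ with $X=(\mathcal{E},e)$ is $(K,w)^X=((W^X,R^X,V^X),(w,e))$ with $W^X=\{(v,f)\in W\times E:K,v\vDash pre(f)\}$, $((v,f),(u,g))\in R^X_i$ iff $(v,u)\in R_i$ and $(f,g)\in Q_i$, $V^X(p)=\{(v,f)\in W^X:K,v\vDash post(f)(p)\}$. $X$ is applicable to $(K,w)$ if $K,w\vDash pre(e)$. Equivalence. $Y\in\mathrm{ALL}$ and $X\in\mathrm{Post}\cup\mathrm{noPost}$ are equivalent iff for all attention states $(M,w)$ and all $\varphi\in\mathcal{L}$: $(M,w)^Y\vDash\varphi$ iff $(K(M,w))^X\vDash\varphi$ (with the convention that the result of a non-applicable update satisfies no formula). *)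

(* Defs.v *)
From mathcomp Require Import all_boot.
From mathcomp Require Import boolp.

Set Implicit Arguments.
Unset Strict Implicit.
Unset Printing Implicit Defensive.

Section Language.

Variables (I : finType) (Phi : countType) (N : nat).

(* 'I_N.+1 is {0, ..., N}. *)
Inductive atom : Type :=
  | PropAtom of Phi
  | AttLt of I & 'I_N.+1
  | AttEq of I & 'I_N.+1.

Inductive form : Type :=
  | Top
  | Atom of atom
  | Neg of form
  | And of form & form
  | Know of I & form.

Definition Imp (phi psi : form) : form := Neg (And phi (Neg psi)).

End Language.

Arguments PropAtom {I Phi N}.
Arguments AttLt {I Phi N}.
Arguments AttEq {I Phi N}.
Arguments Top {I Phi N}.
Arguments Atom {I Phi N}.

Section AttentionStates.

Variables (I : finType) (Phi : countType) (N : nat).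
Local Notation form := (form I Phi N).
Local Notation atom := (atom I Phi N).

(* The bare data of an attention model, without its axioms: in the update of a
   model by an attention action, the accessibility relations need not be
   transitive, since Q i and Q* i are not assumed to have a transitive union,
   and the set of worlds may be empty. *)
Record att_struct : Type := AttStruct {
  att_world :> finType;
  att_rel : I -> rel att_world;
  att_val : atom -> {set att_world};
  att_cap : I -> att_world -> 'I_N.+1
}.

Definition attention_model (M : att_struct) : Prop :=
  [/\ 0 < #|M|,
      forall i, equivalence_rel (@att_rel M i) &
      forall (i : I) (w v : M), att_rel i w v -> att_cap i w = att_cap i v].

Fixpoint att_sat (M : att_struct) (w : M) (phi : form) : bool :=
  match phi with
  | Top => true
  | Atom (PropAtom p) => w \in att_val M (PropAtom p)
  | Atom (AttLt i n) => att_cap i w < n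
  | Atom (AttEq i n) => att_cap i w == n
  | Neg psi => ~~ att_sat w psi
  | And psi chi => att_sat w psi && att_sat w chi
  | Know i psi => [forall v, att_rel i w v ==> att_sat v psi]
  end.

Definition entails (phi psi : form) : Prop :=
  forall M : att_struct, attention_model M ->
  forall w : M, att_sat w (Imp phi psi).

Definition att_pointed : Type := {M : att_struct & M}.

Definition att_pointed_sat (s : att_pointed) (phi : form) : bool :=
  att_sat (projT2 s) phi.

End AttentionStates.

Section AttentionActions.

Variables (I : finType) (Phi : countType) (N : nat).
Local Notation form := (form I Phi N).

Record attention_action_model : Type := AttActionModel {
  aam_event :> finType;
  aam_Q : I -> rel aam_event;
  aam_Qstar : I -> rel aam_event;
  aam_pre : aam_event -> form;
  aam_cost : I -> form -> aam_event -> nat;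
  aam_event_nonempty : 0 < #|aam_event|;
  aam_Q_equiv : forall i, equivalence_rel (aam_Q i);
  aam_Qstar_equiv : forall i, equivalence_rel (aam_Qstar i);
  aam_cost_top : forall i e, aam_cost i Top e = 0;
  aam_cost_inv : forall i phi e e', aam_Q i e e' || aam_Qstar i e e' ->
    aam_cost i phi e = aam_cost i phi e'
}.

Record attention_action : Type := AttAction {
  aa_model :> attention_action_model;
  aa_question : I -> form;
  aa_event : aa_model
}.

(* Q* i [phi | neg phi] *)
Definition Qstar_split (A : attention_action_model) (i : I) (phi : form) :
    rel A :=
  fun e e' => aam_Qstar i e e' &&
    `[< entails (aam_pre e) phi <-> entails (aam_pre e') phi >].

Section Update.

Variables (M : att_struct I Phi N) (X : attention_action).

Definition att_upd_dom : pred (M * X) := fun x => att_sat x.1 (aam_pre x.2).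

Definition att_upd_world : finType := {x : M * X | att_upd_dom x}.

Definition att_upd_rel (i : I) : rel att_upd_world := fun x y =>
  let: (v, f) := val x in
  let: (u, g) := val y in
  att_rel i v u &&
  (if att_cap i v < aam_cost i (aa_question X i) f
   then aam_Q i f g || aam_Qstar i f g
   else aam_Q i f g || Qstar_split i (aa_question X i) f g).

(* The values on the attention atoms are never consulted by att_sat. *)
Definition att_upd_val (p : atom I Phi N) : {set att_upd_world} :=
  [set x | (val x).1 \in att_val M p].

(* The subtraction of nat is truncated at 0. *)
Definition att_upd_cap (i : I) (x : att_upd_world) : 'I_N.+1 :=
  let: (v, f) := val x in
  Ordinal (leq_ltn_trans
    (leq_subr (aam_cost i (aa_question X i) f) (att_cap i v))
    (ltn_ord (att_cap i v))).

Definition att_upd : att_struct I Phi N :=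
  AttStruct att_upd_rel att_upd_val att_upd_cap.

End Update.

(* None exactly when X is not applicable to s, i.e. when the pair (w, e) is not
   a world of the updated model. *)
Definition att_update (s : att_pointed I Phi N) (X : attention_action) :
    option (att_pointed I Phi N) :=
  omap (fun x : att_upd (projT1 s) X =>
          existT (fun M' : att_struct I Phi N => M') (att_upd (projT1 s) X) x)
       (insub (projT2 s, aa_event X)).

End AttentionActions.

Section EpistemicActions.

Variables (I : finType) (Phi : countType) (N : nat).
Local Notation form := (form I Phi N).
Local Notation atom := (atom I Phi N).

(* As for att_struct, only the data: no axiom of epistemic Kripke models. *)
Record kripke_struct : Type := KripkeStruct {
  kr_world :> finType;
  kr_rel : I -> rel kr_world;
  kr_val : atom -> {set kr_world}
}.

Definition kripke_model (K : kripke_struct) : Prop :=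
  0 < #|K| /\ forall i, equivalence_rel (@kr_rel K i).

Fixpoint kr_sat (K : kripke_struct) (w : K) (phi : form) : bool :=
  match phi with
  | Top => true
  | Atom p => w \in kr_val K p
  | Neg psi => ~~ kr_sat w psi
  | And psi chi => kr_sat w psi && kr_sat w chi
  | Know i psi => [forall v, kr_rel i w v ==> kr_sat v psi]
  end.

Definition kr_pointed : Type := {K : kripke_struct & K}.

Definition kr_pointed_sat (s : kr_pointed) (phi : form) : bool :=
  kr_sat (projT2 s) phi.

Definition rendition_struct (M : att_struct I Phi N) : kripke_struct :=
  KripkeStruct (@att_rel I Phi N M) (fun p => [set v | att_sat v (Atom p)]).

Definition rendition (s : att_pointed I Phi N) : kr_pointed :=
  existT (fun K : kripke_struct => K) (rendition_struct (projT1 s)) (projT2 s).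

Lemma rendition_model (M : att_struct I Phi N) :
  attention_model M -> kripke_model (rendition_struct M).
Proof. by case. Qed.

Record action_model : Type := ActionModel {
  am_event :> finType;
  am_Q : I -> rel am_event;
  am_pre : am_event -> form;
  am_post : am_event -> atom -> form;
  am_event_nonempty : 0 < #|am_event|;
  am_Q_equiv : forall i, equivalence_rel (am_Q i)
}.

Record epistemic_action : Type := EpiAction {
  ea_model :> action_model;
  ea_event : ea_model
}.

Definition noPost (X : epistemic_action) : Prop :=
  forall (e : X) (p : atom), am_post e p = Atom p.

Section Update.

Variables (K : kripke_struct) (X : epistemic_action).

Definition kr_upd_dom : pred (K * X) := fun x => kr_sat x.1 (am_pre x.2).

Definition kr_upd_world : finType := {x : K * X | kr_upd_dom x}.

Definition kr_upd_rel (i : I) : rel kr_upd_world := fun x y =>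
  let: (v, f) := val x in
  let: (u, g) := val y in
  kr_rel i v u && am_Q i f g.

Definition kr_upd_val (p : atom) : {set kr_upd_world} :=
  [set x | let: (v, f) := val x in kr_sat v (am_post f p)].

Definition kr_upd : kripke_struct := KripkeStruct kr_upd_rel kr_upd_val.

End Update.

Definition kr_update (s : kr_pointed) (X : epistemic_action) :
    option kr_pointed :=
  omap (fun x : kr_upd (projT1 s) X =>
          existT (fun K' : kripke_struct => K') (kr_upd (projT1 s) X) x)
       (insub (projT2 s, ea_event X)).

End EpistemicActions.

(* The result None of a non-applicable update satisfies no formula. *)
Definition result_sat (S F : Type) (sat : S -> F -> bool) (r : option S)
    (phi : F) : bool :=
  if r is Some s then sat s phi else false.

Definition equivalent (I : finType) (Phi : countType) (N : nat)
    (Y : attention_action I Phi N) (X : epistemic_action I Phi N) : Prop :=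
  forall s : att_pointed I Phi N, attention_model (projT1 s) ->
  forall phi : form I Phi N,
    result_sat (@att_pointed_sat I Phi N) (att_update s Y) phi <->
    result_sat (@kr_pointed_sat I Phi N) (kr_update (rendition s) X) phi.

(* Main.v *)
Require Import Defs.
From mathcomp Require Import all_boot.

Set Implicit Arguments.
Unset Strict Implicit.
Unset Printing Implicit Defensive.

(** If questions are free, no agent ever lacks attention and no capacity is
    consumed. Taking moreover Q* = Q, the relation Q \/ Q*[q|~q] collapses to Q
    whatever the question q is, so the attention update becomes the product
    update. *)

Section FreeAction.

Variables (I : finType) (Phi : countType) (N : nat).
Variable X : epistemic_action I Phi N.

Definition free_action_model : attention_action_model I Phi N :=
  @AttActionModel I Phi N (am_event X) (@am_Q _ _ _ X) (@am_Q _ _ _ X)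
    (@am_pre _ _ _ X) (fun _ _ _ => 0) (am_event_nonempty X)
    (@am_Q_equiv _ _ _ X) (@am_Q_equiv _ _ _ X)
    (fun _ _ => erefl) (fun _ _ _ _ _ => erefl).

Definition free_action : attention_action I Phi N :=
  @AttAction I Phi N free_action_model (fun _ => Top) (ea_event X).

(** The rendition turns the truth set of each atom into its valuation and keeps the relations, so
    only the atomic case has content. *)
Lemma kr_sat_rendition (M : att_struct I Phi N) (phi : form I Phi N) (w : M) :
  @kr_sat I Phi N (rendition_struct M) w phi = att_sat w phi.
Proof.
elim: phi w => [|p|phi IH|phi IH1 psi IH2|i phi IH] w //=.
- by rewrite inE.
- by rewrite IH.
- by rewrite IH1 IH2.
- by apply: eq_forallb => v; rewrite IH.
Qed.

Variable M : att_struct I Phi N.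
Local Notation attX := (att_upd M free_action).
Local Notation krX := (kr_upd (rendition_struct M) X).

Lemma free_upd_relE (i : I) (x y : attX) :
  att_rel i x y =
  att_rel i (val x).1 (val y).1 && @am_Q _ _ _ X i (val x).2 (val y).2.
Proof.
case: x y => -[v f] ? [[u g] ?] /=; rewrite /att_upd_rel /= /Qstar_split /=.
(* At cost 0 the capacity suffices, and absorption gives Q || (Q && split) = Q. *)
by case: (am_Q i f g).
Qed.

Lemma free_upd_capE (i : I) (x : attX) :
  att_cap i x = att_cap i (val x).1 :> nat.
Proof. by case: x => -[v f] ?; rewrite /= /att_upd_cap /= subn0. Qed.

Lemma free_upd_dom (x : M * X) :
  kr_upd_dom (K := rendition_struct M) x = att_upd_dom (X := free_action) x.
Proof. exact: kr_sat_rendition. Qed.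

(** The two updates live on different subtypes of [M * X], so worlds are matched by their underlying
    pairs. Both [x] and [y] vary in the induction, since [Know] moves to successors. *)
Lemma free_upd_sat (hX : noPost X) (phi : form I Phi N) (x : attX) (y : krX) :
  val x = val y -> att_sat x phi = kr_sat y phi.
Proof.
elim: phi x y => [|p|phi IH|phi IH1 psi IH2|i phi IH] x y exy //.
(* Without postconditions, an atom keeps the truth value it had before the product update. *)
- have -> : kr_sat y (Atom p) = att_sat (val x).1 (Atom p).
    rewrite /= inE exy; case: y {exy} => -[v f] ? /=.
    by rewrite hX kr_sat_rendition.
  case: p => [p|i n|i n].
  + by rewrite /= inE.
  + by rewrite [LHS]/= free_upd_capE.
  + by rewrite [LHS]/= -val_eqE /= free_upd_capE.
- by rewrite /= (IH x y).
- by rewrite /= (IH1 x y) // (IH2 x y).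
- have relE (x' : attX) (y' : krX) : val x' = val y' ->
      att_rel i x x' = kr_rel i y y'.
    rewrite free_upd_relE => ->; rewrite exy.
    by case: y y' {exy} => -[v f] ? [[u g] ?].
  apply/forallP/forallP => sat z.
  (* Equal domains give the successor [z] a counterpart [x'] with the same pair. *)
  + have dz : att_upd_dom (X := free_action) (val z).
      by rewrite -free_upd_dom; exact: (valP z).
    pose x' : attX := Sub (val z) dz.
    have ex' : val x' = val z by rewrite SubK.
    by rewrite -[X in _ ==> X]/(kr_sat z phi) -(relE x') // -(IH x').
  + have dz : kr_upd_dom (K := rendition_struct M) (val z).
      by rewrite free_upd_dom; exact: (valP z).
    pose y' : krX := Sub (val z) dz.
    have ey' : val z = val y' by rewrite SubK.
    by rewrite -[X in _ ==> X]/(att_sat z phi) (relE z y') // (IH z y').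
Qed.

End FreeAction.

Theorem proposition18 (I : finType) (hI : 0 < #|I|) (Phi : countType) (N : nat)
    (X : epistemic_action I Phi N) (hX : noPost X) :
  exists Y : attention_action I Phi N, equivalent Y X.
Proof.
exists (free_action X) => -[M w] _ phi.
rewrite /att_update /kr_update /=.
(* The cases are applicability of each action; equal domains exclude the two mixed ones. *)
case: insubP => [x dx ex|ndx]; case: insubP => [y dy ey|ndy] //=.
- rewrite /att_pointed_sat /kr_pointed_sat /=.
  by rewrite (free_upd_sat hX phi (etrans ex (esym ey))).
- by move: ndy; rewrite free_upd_dom dx.
- by move: ndx; rewrite -free_upd_dom dy.
Qed.
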